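(* Let $v$ be a quasi-normal typical weight on the unit disk $\mathbb{D}$. No nontrivial semigroup of analytic functions induces a strongly continuous semigroup of weighted composition operators on $H_v^\infty$. In other words, if $\{\varphi_t\}$ is a nontrivial semigroup of analytic functions for which the operators $T_tf=\varphi_t'\,(f\circ\varphi_t)$ are bounded on $H_v^\infty$ with $\sup_{0\le t\le1}\|T_t\|<\infty$, then $$[\varphi_t',H_v^\infty]\subsetneq H_v^\infty.$$
   Context: A semigroup of analytic functions is a family $\{\varphi_t:t\ge 0\}$ of analytic self-maps of $\mathbb{D}$ such that $\varphi_0$ is the identity, $\varphi_{t+s}=\varphi_t\circ\varphi_s$ for all $t,s\ge0$, and $\varphi_t\to\varphi_0$ uniformly on compact subsets of $\mathbb{D}$ as $t\to0$; it is nontrivial if some $\varphi_t$ is not the identity. $\varphi_t'=\partial\varphi_t/\partial z$. A weight is a bounded, continuous, positive, radial function $v:\mathbb{D}\to\mathbb{R}_+$ (we write $v(r)=v(z)$ for $|z|=r$); it is typical if $\lim_{|z|\to1}v(z)=0$. $H_v^\infty$ is the Banach space of analytic $f$ on $\mathbb{D}$ with $\|f\|_v=\sup_{z\in\mathbb{D}}v(z)|f(z)|<\infty$. A weight $v$ is quasi-normal if, for analytic $f$ on $\mathbb{D}$, $f\in H_v^\infty$ if and only if $\sup_{z\in\mathbb{D}}(1-|z|^2)v(z)|f'(z)|<\infty$. For a Banach space $X$ of analytic functions on $\mathbb{D}$ on which the $T_t$ are bounded, $[\varphi_t',X]=\{f\in X:\lim_{t\to0^+}\|\varphi_t'(f\circ\varphi_t)-f\|_X=0\}$.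 The semigroup $\{T_t\}$ is strongly continuous on $X$ if $\lim_{t\to0^+}\|T_tf-f\|_X=0$ for every $f\in X$, that is, if $[\varphi_t',X]=X$. *)

(* Defs.v *)
From Stdlib Require Import Reals List.
From Coquelicot Require Import Coquelicot.
Open Scope R_scope.

(* Functions on the unit disk are represented by total functions on [C]; every
   notion below only depends on their values inside the disk. *)
Definition disk (z : C) : Prop := Cmod z < 1.

(* The library's [C_derive] is a total operator; it is the complex derivative
   wherever [ex_derive] holds over [C] ([C_derive_correct]). *)
Definition analytic (f : C -> C) : Prop :=
  forall z : C, disk z -> ex_derive (K := C_AbsRing) (V := C_NormedModule) f z.

Definition compact_set {T : UniformSpace} (K : T -> Prop) : Prop :=
  forall (I : Type) (U : I -> T -> Prop),
    (forall i, open (U i)) ->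
    (forall x, K x -> exists i, U i x) ->
    exists l : list I, forall x, K x -> exists i, In i l /\ U i x.

Record analytic_semigroup (phi : R -> C -> C) : Prop := {
  semigroup_analytic : forall t, 0 <= t -> analytic (phi t);
  semigroup_self_map : forall t z, 0 <= t -> disk z -> disk (phi t z);
  semigroup_id : forall z, disk z -> phi 0 z = z;
  semigroup_comp : forall t s z, 0 <= t -> 0 <= s -> disk z ->
    phi (t + s) z = phi t (phi s z);
  semigroup_cont : forall K : C -> Prop,
    compact_set (T := C_UniformSpace) K -> (forall z, K z -> disk z) ->
    forall eps : posreal,
      at_right 0 (fun t => forall z, K z -> Cmod (phi t z - phi 0 z) < eps) }.

Definition nontrivial_semigroup (phi : R -> C -> C) : Prop :=
  exists t, 0 <= t /\ exists z, disk z /\ phi t z <> z.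

Record weight (v : C -> R) : Prop := {
  weight_bounded : exists M, forall z, disk z -> v z <= M;
  weight_continuous : forall z, disk z ->
    continuous (T := C_UniformSpace) (U := R_UniformSpace) v z;
  weight_positive : forall z, disk z -> 0 < v z;
  weight_radial : forall z w, disk z -> disk w -> Cmod z = Cmod w -> v z = v w }.

Definition typical (v : C -> R) : Prop :=
  forall eps : posreal, exists r, r < 1 /\
    forall z, r < Cmod z -> disk z -> Rabs (v z) < eps.

Definition wnorm (v : C -> R) (f : C -> C) : Rbar :=
  Lub_Rbar (fun x => exists z, disk z /\ x = v z * Cmod (f z)).

Definition Hinf (v : C -> R) (f : C -> C) : Prop :=
  analytic f /\ Rbar_lt (wnorm v f) p_infty.

Definition quasi_normal (v : C -> R) : Prop :=
  forall f, analytic f ->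
    (Hinf v f <->
     Rbar_lt (wnorm (fun z => (1 - Cmod z ^ 2) * v z) (C_derive f)) p_infty).

Definition wcomp (phi : R -> C -> C) (t : R) (f : C -> C) : C -> C :=
  fun z => (C_derive (phi t) z * f (phi t z))%C.

(* [real] sends infinite values to 0, so this is the operator norm only for an
   operator mapping [Hinf v] to itself, as [bounded_on] requires. *)
Definition opnorm (v : C -> R) (T : (C -> C) -> C -> C) : Rbar :=
  Lub_Rbar (fun x => exists f, Hinf v f /\ Rbar_le (wnorm v f) 1 /\
                               x = real (wnorm v (T f))).

Definition bounded_on (v : C -> R) (T : (C -> C) -> C -> C) : Prop :=
  (forall f, Hinf v f -> Hinf v (T f)) /\ Rbar_lt (opnorm v T) p_infty.

(* The space [phi_t', H_v^infty]. The limit is spelled out because [wnorm] is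
   [Rbar]-valued. *)
Definition cont_space (phi : R -> C -> C) (v : C -> R) (f : C -> C) : Prop :=
  Hinf v f /\
  forall eps : posreal,
    at_right 0 (fun t =>
      Rbar_lt (wnorm v (fun z => (wcomp phi t f z - f z)%C)) eps).

(* Main.v *)
Require Import Defs.
From Stdlib Require Import Reals Lra Lia ClassicalEpsilon.
From Coquelicot Require Import Coquelicot.
Open Scope R_scope.

(** Let [A n] be the norm of [z^n] in [H_v^infty]. If the semigroup were strongly
continuous, one could build a function [f = sum_k z^(p_k) / A (n_k)], [p_k >= n_k],
by a gliding hump: since [v] is typical, each monomial lives on an annulus that is
disjoint, up to small errors, from those of the other ones. The function [f] is
discontinuous along the semigroup as soon as, for arbitrarily small [t] and large
[n], some [p >= n] has [||T_t z^p - z^p|| > A n / 16].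

If there were no such [p], then for a fixed small [t], on a circle [|z| = r] where
[v r^n] is nearly [A n], all the numbers [phi_t' (phi_t/z)^(n+m)] with [r^m >= 1/2]
would be close to [1]. Hence so would the powers [(phi_t/z)^m], which forces
[|phi_t(z) - z| <= 1/M] on that circle, [M] being the largest such [m]. As [n] grows,
[r] tends to [1] and [M] to infinity, and the maximum principle gives
[phi_t(z) = z].

The maximum principle is only needed for functions whose derivative is again
differentiable, here because [phi_t' = T_t 1]; it then follows from the second
derivative test applied to [Re (c F) + eps |z|^2]. *)

(** * Derivatives in epsilon-delta form and along real lines *)

(** Replaces the filters of [is_derive] by explicit radii, once for every [AbsRing], so that the
    complex and real versions below are instances by conversion. *)
Lemma is_deriveP {K : AbsRing} {V : NormedModule K} (f : K -> V) (z : K) (l : V) :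
  is_derive f z l <->
  forall eps, 0 < eps -> exists d, 0 < d /\ forall w, abs (minus w z) < d ->
    norm (minus (minus (f w) (f z)) (scal (minus w z) l)) <= eps * abs (minus w z).
Proof.
split.
- intros [_ H] eps He.
  destruct (H z (fun P HP => HP) (mkposreal eps He)) as [d Hd].
  exists d; split; [apply cond_pos|].
  intros w Hw; exact (Hd w Hw).
- intros H; split.
  + apply is_linear_scal_l.
  + intros x Hx.
    rewrite <- (is_filter_lim_locally_unique (V := AbsRing_NormedModule K) _ _ Hx).
    intros eps. destruct (H eps (cond_pos eps)) as [d [Hd0 Hd]].
    exists (mkposreal d Hd0); intros w Hw; exact (Hd w Hw).
Qed.

Lemma C_is_deriveP (f : C -> C) (z l : C) :
  is_derive (K := C_AbsRing) (V := C_NormedModule) f z l <->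
  forall eps, 0 < eps -> exists d, 0 < d /\ forall w, Cmod (w - z) < d ->
    Cmod (f w - f z - (w - z) * l) <= eps * Cmod (w - z).
Proof. exact (is_deriveP (K := C_AbsRing) (V := C_NormedModule) f z l). Qed.

Lemma R_is_deriveP (f : R -> R) (z l : R) :
  is_derive f z l <->
  forall eps, 0 < eps -> exists d, 0 < d /\ forall w, Rabs (w - z) < d ->
    Rabs (f w - f z - (w - z) * l) <= eps * Rabs (w - z).
Proof. exact (is_deriveP (K := R_AbsRing) (V := R_NormedModule) f z l). Qed.

Lemma C_derive_spec (f : C -> C) (z : C) : analytic f -> disk z ->
  is_derive (K := C_AbsRing) (V := C_NormedModule) f z (C_derive f z).
Proof. intros Hf Hz; apply C_derive_correct; [exact z|now apply Hf]. Qed.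

(** Transfers complex derivatives to real functions of one variable, for the second derivative test;
    the constant [c] will rotate a value of [f] onto the positive reals. *)
Lemma is_derive_Re_line (f : C -> C) (z l c d : C) (s : R) :
  is_derive (K := C_AbsRing) (V := C_NormedModule) f (z + s * d)%C l ->
  is_derive (fun x : R => Re (c * f (z + x * d))%C) s (Re (c * d * l)%C).
Proof.
rewrite C_is_deriveP, R_is_deriveP; intros H eps He.
(* The added [1] keeps the denominator positive when [c] or [d] vanishes. *)
assert (H0 : 0 < Cmod c * Cmod d + 1)
  by (pose proof (Rmult_le_pos _ _ (Cmod_ge_0 c) (Cmod_ge_0 d)); lra).
destruct (H (eps / (Cmod c * Cmod d + 1))) as [r [Hr0 Hr]];
  [now apply Rdiv_lt_0_compat|].
assert (Hd1 : 0 < Cmod d + 1) by (pose proof (Cmod_ge_0 d); lra).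
exists (r / (Cmod d + 1)); split; [now apply Rdiv_lt_0_compat|].
intros x Hx.
assert (E : Cmod ((z + x * d) - (z + s * d))%C = Rabs (x - s) * Cmod d).
{ rewrite <- Cmod_R, <- Cmod_mult; f_equal.
  rewrite RtoC_minus; ring. }
assert (Hw : Cmod ((z + x * d) - (z + s * d))%C < r).
{ rewrite E. apply (Rmult_lt_compat_r (Cmod d + 1)) in Hx; [|lra].
  replace (r / (Cmod d + 1) * (Cmod d + 1)) with r in Hx by (field; lra).
  pose proof (Rabs_pos (x - s)); nra. }
specialize (Hr _ Hw); rewrite E in Hr.
replace (Re (c * f (z + x * d))%C - Re (c * f (z + s * d))%C - (x - s) * Re (c * d * l)%C)
  with (Re (c * (f (z + x * d) - f (z + s * d) - ((z + x * d) - (z + s * d)) * l))%C).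
2:{ destruct c, d, l, z, (f _), (f _); simpl; ring. }
eapply Rle_trans; [apply re_le_Cmod|]. rewrite Cmod_mult.
eapply Rle_trans; [apply Rmult_le_compat_l; [apply Cmod_ge_0|apply Hr]|].
pose proof (Cmod_ge_0 c) as Hc; pose proof (Cmod_ge_0 d) as Hd.
pose proof (Rabs_pos (x - s)) as Hxs.
replace (Cmod c * (eps / (Cmod c * Cmod d + 1) * (Rabs (x - s) * Cmod d)))
  with (eps * Rabs (x - s) * ((Cmod c * Cmod d) / (Cmod c * Cmod d + 1))) by (field; lra).
rewrite <- (Rmult_1_r (eps * Rabs (x - s))) at 2.
apply Rmult_le_compat_l; [nra|].
apply Rle_div_l; lra.
Qed.

(** * The maximum principle *)

(** Since [h1] starts at a nonnegative value with positive slope, it is positive just to the right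
    of [0], and [h] increases there by the mean value theorem. *)
Lemma no_local_max (h h1 : R -> R) (d eta : R) :
  0 < eta -> 0 < d -> 0 <= h1 0 ->
  (forall s, Rabs s < eta -> is_derive h s (h1 s)) ->
  is_derive h1 0 d ->
  exists s, Rabs s < eta /\ h 0 < h s.
Proof.
intros Heta Hd H10 Hh Hh1.
destruct (proj1 (R_is_deriveP _ _ _) Hh1 (d / 2)) as [r [Hr0 Hr]]; [lra|].
set (s := Rmin eta r / 2).
assert (Hs : 0 < s < eta /\ s < r).
{ unfold s; pose proof (Rmin_l eta r); pose proof (Rmin_r eta r).
  pose proof (Rmin_pos eta r Heta Hr0); lra. }
assert (Hpos : forall x, 0 < x <= s -> 0 < h1 x).
{ intros x Hx. specialize (Hr x).
  rewrite !Rminus_0_r, (Rabs_pos_eq x) in Hr by lra.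
  specialize (Hr ltac:(lra)).
  apply Rabs_le_between in Hr; nra. }
exists s; split; [rewrite Rabs_pos_eq; lra|].
destruct (MVT_cor2 h h1 0 s) as [x [Hx1 Hx2]]; [lra| |].
- intros x Hx; apply is_derive_Reals, Hh; rewrite Rabs_pos_eq; lra.
- assert (0 < h1 x) by (apply Hpos; lra). nra.
Qed.

Lemma Cmod_sqr_line (z d : C) (s : R) : Cmod d = 1 ->
  Cmod (z + s * d)%C ^ 2 = Cmod z ^ 2 + 2 * s * Re (z * Cconj d)%C + s ^ 2.
Proof.
intros Hd; assert (E : Cmod d ^ 2 = 1) by (rewrite Hd; ring).
rewrite Cmod2_alt in E. rewrite !Cmod2_alt.
rewrite <- (Rmult_1_r (s ^ 2)), <- E.
destruct z, d; simpl; ring.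
Qed.

(** The real part of [c F] is harmonic, so some direction has a nonnegative second derivative; the
    quadratic term makes it at least [2 * eps], and reversing the direction if necessary makes the
    first derivative nonnegative. *)
Lemma no_interior_max (F : C -> C) (c z : C) (eps eta : R) :
  analytic F -> analytic (C_derive F) -> 0 < eps -> 0 < eta -> Cmod z + eta < 1 ->
  exists w, Cmod (w - z) < eta /\
    Re (c * F z)%C + eps * Cmod z ^ 2 < Re (c * F w)%C + eps * Cmod w ^ 2.
Proof.
intros HF HF' He Heta Hz.
set (A := Re (c * C_derive (C_derive F) z)%C).
(* The second derivatives of [Re (c F)] in the directions [1] and [Ci] are opposite,
   and its first derivatives in the directions [d] and [- d] are opposite. *)
assert (Hd : exists d : C, Cmod d = 1 /\
   0 <= Re (c * d * d * C_derive (C_derive F) z)%C /\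
   0 <= Re (c * d * C_derive F z)%C + eps * (2 * Re (z * Cconj d)%C)).
{ assert (Hd0 : exists d : C, Cmod d = 1 /\
    0 <= Re (c * d * d * C_derive (C_derive F) z)%C).
  { destruct (Rle_dec 0 A) as [HA|HA].
    - exists 1; rewrite Cmod_1; split; [easy|]. rewrite !Cmult_1_r; exact HA.
    - exists Ci; rewrite Cmod_Ci; split; [easy|].
      replace (c * Ci * Ci * C_derive (C_derive F) z)%C
        with (- (c * C_derive (C_derive F) z))%C.
      + unfold A in HA. rewrite re_opp. lra.
      + replace (c * Ci * Ci)%C with (c * (Ci * Ci))%C by ring.
        replace (Ci * Ci)%C with (- (1))%C
          by (apply injective_projections; simpl; ring).
        ring. }
  destruct Hd0 as [d [Hd1 Hd2]].
  destruct (Rle_dec 0 (Re (c * d * C_derive F z)%C + eps * (2 * Re (z * Cconj d)%C)))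
    as [H|H]; [exists d; tauto|].
  exists (- d)%C; rewrite Cmod_opp; split; [easy|]; split.
  - replace (c * - d * - d)%C with (c * d * d)%C by ring; easy.
  - replace (c * - d * C_derive F z)%C with (- (c * d * C_derive F z))%C by ring.
    replace (z * Cconj (- d))%C with (- (z * Cconj d))%C
      by (destruct z, d; apply injective_projections; simpl; ring).
    rewrite !re_opp; lra. }
destruct Hd as [d [Hd1 [Hd2 Hd3]]].
assert (Hline : forall s : R, Rabs s < eta -> disk (z + s * d)%C).
{ intros s Hs; unfold disk. eapply Rle_lt_trans; [apply Cmod_triangle|].
  rewrite Cmod_mult, Cmod_R, Hd1; lra. }
destruct (no_local_max
  (fun s : R => Re (c * F (z + s * d))%C + eps * (Cmod z ^ 2 + 2 * s * Re (z * Cconj d)%C + s ^ 2))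
  (fun s : R => Re (c * d * C_derive F (z + s * d))%C + eps * (2 * Re (z * Cconj d)%C + 2 * s))
  (Re (c * d * d * C_derive (C_derive F) z)%C + eps * 2) eta) as [s [Hs1 Hs2]]; try lra.
- replace (z + 0 * d)%C with z by ring. lra.
- intros s Hs. apply (is_derive_plus (V := R_NormedModule)).
  + apply is_derive_Re_line, C_derive_spec; auto.
  + generalize (Re (z * Cconj d)%C) (Cmod z); intros b m.
    auto_derive; [easy|simpl; ring].
- apply (is_derive_plus (V := R_NormedModule)).
  + apply (is_derive_Re_line (C_derive F) z _ (c * d)%C d).
    replace (z + 0 * d)%C with z by ring.
    apply C_derive_spec; auto. unfold disk; lra.
  + generalize (Re (z * Cconj d)%C) (Cmod z); intros b m.
    auto_derive; [easy|simpl; ring].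
- exists (z + s * d)%C; split.
  + replace (z + s * d - z)%C with (s * d)%C by ring.
    rewrite Cmod_mult, Cmod_R, Hd1; lra.
  + rewrite (Cmod_sqr_line z d s) by easy.
    replace (z + 0 * d)%C with z in Hs2 by ring. lra.
Qed.

(** Compactness of the closed disk, for a property [P d] that weakens as [d] decreases: local values
    of [d] can be replaced by a uniform one. *)
Lemma closed_disk_uniform (r : R) (P : R -> C -> Prop) :
  (forall d e w, 0 < d <= e -> P e w -> P d w) ->
  (forall z, Cmod z <= r ->
    exists d, 0 < d /\ forall w, Cmod w <= r -> Cmod (w - z) < d -> P d w) ->
  exists d, 0 < d /\ forall w, Cmod w <= r -> P d w.
Proof.
intros Hmono Hloc.
(* Compactness is applied on a square. Its points outside the disk have neighbourhoods that miss the
   disk, where the local claim is vacuous. *)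
assert (Hloc' : forall z, exists d, 0 < d /\
   forall w, Cmod w <= r -> Cmod (w - z) < d -> P d w).
{ intros z; destruct (Rle_dec (Cmod z) r) as [Hz|Hz]; [now apply Hloc|].
  exists (Cmod z - r); split; [lra|].
  intros w Hw Hwz; exfalso.
  assert (Cmod z <= Cmod w + Cmod (w - z)); [|lra].
  replace z with (w + - (w - z))%C at 1 by ring.
  rewrite <- (Cmod_opp (w - z)). apply Cmod_triangle. }
destruct (choice _ Hloc') as [g Hg].
(* Halving the gauge lets the two coordinate differences add up to less than [g (x, y)]. *)
assert (Hg2 : forall x y, 0 < g (x, y) / 2).
{ intros x y; destruct (Hg (x, y)); lra. }
destruct (compactness_value_2d (- r) r (- r) r
  (fun x y => mkposreal _ (Hg2 x y))) as [d Hd].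
exists d; split; [apply cond_pos|].
intros [x y] Hw; apply NNPP; intros Hn.
pose proof (Rmax_Cmod (x, y)) as Hm; simpl in Hm.
pose proof (Rle_trans _ _ _ (Rmax_l _ _) (Rle_trans _ _ _ Hm Hw)) as Hx.
pose proof (Rle_trans _ _ _ (Rmax_r _ _) (Rle_trans _ _ _ Hm Hw)) as Hy.
apply Rabs_le_between in Hx; apply Rabs_le_between in Hy.
apply (Hd x y); [lra|lra|].
intros [u [v [_ [_ [Hu [Hv Hduv]]]]]]; simpl in Hu, Hv, Hduv; apply Hn.
destruct (Hg (u, v)) as [Hg0 Hg1].
apply (Hmono d (g (u, v))).
- split; [apply cond_pos|lra].
- apply Hg1; [exact Hw|].
  replace ((x, y) - (u, v))%C with ((x - u) + Ci * (y - v))%C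
    by (apply injective_projections; simpl; ring).
  eapply Rle_lt_trans; [apply Cmod_triangle|].
  rewrite Cmod_mult, Cmod_Ci, <- !RtoC_minus, !Cmod_R; lra.
Qed.

(** An upper semicontinuous function is bounded above on a compact set; were its supremum [S] not
    attained, compactness would give a uniform gap below [S]. *)
Lemma closed_disk_max (r : R) (u : C -> R) : 0 <= r ->
  (forall z, Cmod z <= r -> forall eps, 0 < eps -> exists d, 0 < d /\
     forall w, Cmod w <= r -> Cmod (w - z) < d -> u w < u z + eps) ->
  exists z, Cmod z <= r /\ forall w, Cmod w <= r -> u w <= u z.
Proof.
intros Hr Hu.
(* The bound [/ d + 1] grows as [d] shrinks, as monotonicity in [d] requires. *)
destruct (closed_disk_uniform r (fun d w => u w <= / d + 1)) as [b [Hb0 Hb]].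
- intros d e w Hd H. assert (/ e <= / d) by (apply Rinv_le_contravar; lra). lra.
- intros z Hz; destruct (Hu z Hz 1) as [d [Hd0 Hd]]; [lra|].
  pose proof (Rabs_pos (u z)) as Habs; pose proof (Rle_abs (u z)).
  exists (Rmin d (/ (Rabs (u z) + 1))).
  assert (H1 : 0 < / (Rabs (u z) + 1)) by (apply Rinv_0_lt_compat; lra).
  assert (H2 : 0 < Rmin d (/ (Rabs (u z) + 1))) by now apply Rmin_pos.
  split; [easy|].
  intros w Hw Hwz.
  assert (/ / (Rabs (u z) + 1) <= / Rmin d (/ (Rabs (u z) + 1)))
    by (apply Rinv_le_contravar; [easy|apply Rmin_r]).
  rewrite Rinv_inv in H0.
  specialize (Hd w Hw (Rlt_le_trans _ _ _ Hwz (Rmin_l _ _))). lra.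
- destruct (completeness (fun x => exists w, Cmod w <= r /\ x = u w)) as [S [HS1 HS2]].
  + exists (/ b + 1); intros x [w [Hw ->]]; auto.
  + exists (u 0); exists 0; rewrite Cmod_0; auto.
  + apply NNPP; intros Hn.
    assert (Hlt : forall z, Cmod z <= r -> u z < S).
    { intros z Hz; apply Rnot_le_lt; intros HSz; apply Hn; exists z; split; [easy|].
      intros w Hw; apply Rle_trans with S; [apply HS1; eauto|easy]. }
    destruct (closed_disk_uniform r (fun d w => u w <= S - d)) as [d [Hd0 Hd]].
    * intros; lra.
    * intros z Hz; specialize (Hlt z Hz).
      destruct (Hu z Hz ((S - u z) / 2)) as [d [Hd0 Hd]]; [lra|].
      exists (Rmin d ((S - u z) / 2)); split; [apply Rmin_pos; lra|].
      intros w Hw Hwz.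
      specialize (Hd w Hw (Rlt_le_trans _ _ _ Hwz (Rmin_l _ _))).
      pose proof (Rmin_r d ((S - u z) / 2)); lra.
    * assert (S <= S - d); [|lra].
      apply HS2; intros x [w [Hw ->]]; auto.
Qed.

Lemma is_derive_C_continuous (f : C -> C) (z l : C) :
  is_derive (K := C_AbsRing) (V := C_NormedModule) f z l ->
  forall eps, 0 < eps -> exists d, 0 < d /\ forall w, Cmod (w - z) < d ->
    Cmod (f w - f z) < eps.
Proof.
intros H eps He; destruct (proj1 (C_is_deriveP _ _ _) H 1) as [d [Hd0 Hd]]; [lra|].
pose proof (Cmod_ge_0 l) as Hl.
exists (Rmin d (eps / (2 * (Cmod l + 1)))); split.
- apply Rmin_pos; [easy|apply Rdiv_lt_0_compat; lra].
- intros w Hw.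
  specialize (Hd w (Rlt_le_trans _ _ _ Hw (Rmin_l _ _))).
  pose proof (Rlt_le_trans _ _ _ Hw (Rmin_r _ _)) as Hw2.
  apply Rlt_div_r in Hw2; [|lra].
  pose proof (Cmod_triangle (f w - f z - (w - z) * l) ((w - z) * l)) as H1.
  replace (f w - f z - (w - z) * l + (w - z) * l)%C with (f w - f z)%C in H1 by ring.
  rewrite Cmod_mult in H1.
  pose proof (Cmod_ge_0 (w - z)); nra.
Qed.

Lemma Cmod_unimodular (z : C) : exists c, Cmod c = 1 /\ Re (c * z)%C = Cmod z.
Proof.
destruct (excluded_middle_informative (z = 0)) as [->|Hz].
- exists 1; rewrite Cmod_1, Cmod_0; split; [easy|simpl; ring].
- assert (Hm : Cmod z <> 0) by (intros H; apply Hz; now apply Cmod_eq_0).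
  exists (Cconj z / Cmod z)%C.
  assert (Hm' : RtoC (Cmod z) <> 0) by (intros H; apply Hm; now apply RtoC_inj).
  split.
  + rewrite Cmod_div, Cmod_conj, Cmod_R, Rabs_pos_eq by (easy || apply Cmod_ge_0).
    field; easy.
  + replace (Cconj z / Cmod z * z)%C with (z * Cconj z / Cmod z)%C by (field; easy).
    rewrite <- Cmod2_conj.
    rewrite <- RtoC_div by easy; unfold Re, RtoC; cbn [fst]; field; easy.
Qed.

(** Let [2 * e] be the excess of [Cmod (F z0)] over [m]. After a rotation, [Re (c F) + e |z|^2]
    exceeds [m + e] at [z0] but not on the circle, so its maximum would be interior. *)
Lemma maximum_principle (F : C -> C) (r m : R) :
  analytic F -> analytic (C_derive F) -> r < 1 ->
  (forall z, Cmod z = r -> Cmod (F z) <= m) ->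
  forall z, Cmod z <= r -> Cmod (F z) <= m.
Proof.
intros HF HF' Hr Hm z0 Hz0; apply Rnot_lt_le; intros Hlt.
destruct (Cmod_unimodular (F z0)) as [c [Hc1 Hc2]].
pose proof (Cmod_ge_0 z0) as H0.
set (e := (Cmod (F z0) - m) / 2).
assert (He : 0 < e) by (unfold e; lra).
destruct (closed_disk_max r (fun z => Re (c * F z)%C + e * Cmod z ^ 2))
  as [z1 [Hz1 Hmax]]; [lra| |].
- intros z Hz eps Heps.
  assert (Hdz : disk z) by (unfold disk; lra).
  destruct (is_derive_C_continuous F z _ (C_derive_spec F z HF Hdz) (eps / 2))
    as [d [Hd0 Hd]]; [lra|].
  (* Inside the unit disk [|w|^2 - |z|^2 <= 2 |w - z|], so the quadratic term contributes at most
     [eps / 2]. *)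
  exists (Rmin d (eps / (4 * e))); split.
  { apply Rmin_pos; [easy|apply Rdiv_lt_0_compat; lra]. }
  intros w Hw Hwz.
  specialize (Hd w (Rlt_le_trans _ _ _ Hwz (Rmin_l _ _))).
  pose proof (Rlt_le_trans _ _ _ Hwz (Rmin_r _ _)) as Hw2.
  apply Rlt_div_r in Hw2; [|lra].
  assert (Re (c * F w)%C - Re (c * F z)%C < eps / 2).
  { replace (Re (c * F w)%C - Re (c * F z)%C) with (Re (c * (F w - F z))%C)
      by (destruct c, (F w), (F z); simpl; ring).
    eapply Rle_lt_trans; [eapply Rle_trans; [apply Rle_abs|apply re_le_Cmod]|].
    rewrite Cmod_mult, Hc1; lra. }
  assert (Cmod w <= Cmod z + Cmod (w - z)).
  { replace w with (z + (w - z))%C at 1 by ring. apply Cmod_triangle. }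
  pose proof (Cmod_ge_0 w); pose proof (Cmod_ge_0 z); pose proof (Cmod_ge_0 (w - z)).
  assert (Cmod w ^ 2 - Cmod z ^ 2 <= 2 * Cmod (w - z)) by (simpl; nra).
  nra.
- assert (H1 : m + e < Re (c * F z1)%C + e * Cmod z1 ^ 2).
  { specialize (Hmax z0 Hz0); rewrite Hc2 in Hmax.
    pose proof (pow2_ge_0 (Cmod z0)). unfold e in *; nra. }
  destruct (Req_dec (Cmod z1) r) as [E|E].
  + specialize (Hm z1 E).
    assert (Re (c * F z1)%C <= m).
    { eapply Rle_trans; [eapply Rle_trans; [apply Rle_abs|apply re_le_Cmod]|].
      rewrite Cmod_mult, Hc1; lra. }
    rewrite E in H1; assert (r ^ 2 <= 1) by (simpl; nra). nra.
  + destruct (no_interior_max F c z1 e (r - Cmod z1)) as [w [Hw1 Hw2]]; try easy; try lra.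
    assert (Cmod w <= r).
    { replace w with (z1 + (w - z1))%C by ring.
      eapply Rle_trans; [apply Cmod_triangle|lra]. }
    specialize (Hmax w H); lra.
Qed.

(** * Elementary estimates on powers, and closure properties of analyticity *)

(** In [q^M - 1 = (q - 1) S] with [S = 1 + q + ... + q^(M-1)], each summand has real part at least
    [1/2], so [|S| >= M/2]. *)
Lemma powers_near_1 (q : C) (M : nat) :
  (forall m, (m <= M)%nat -> Cmod (q ^ m - 1) <= / 2) ->
  INR M * Cmod (q - 1) <= 1.
Proof.
intros H.
assert (HS : forall m, (m <= M)%nat -> exists S : C,
   (q ^ m - 1 = (q - 1) * S)%C /\ INR m / 2 <= Re S).
{ induction m as [|m IH]; intros Hm.
  - exists 0; split; [simpl; ring|simpl; lra].
  - destruct (IH ltac:(lia)) as [S [HS1 HS2]].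
    exists (S + q ^ m)%C; split.
    + rewrite Cmult_plus_distr_l, <- HS1; simpl; ring.
    + rewrite S_INR. specialize (H m ltac:(lia)).
      pose proof (re_le_Cmod (q ^ m - 1)) as Hre.
      apply Rabs_le_between in Hre.
      unfold Re in *; simpl in *; lra. }
destruct (HS M (le_n M)) as [S [HS1 HS2]].
specialize (H M (le_n M)); rewrite HS1, Cmod_mult in H.
pose proof (Rle_trans _ _ _ (Rle_abs _) (re_le_Cmod S)).
pose proof (Cmod_ge_0 (q - 1)); nra.
Qed.

Lemma Bernoulli_minus (x : R) (n : nat) : 0 <= x <= 1 -> 1 - INR n * x <= (1 - x) ^ n.
Proof.
intros Hx; induction n as [|n IH]; [simpl; lra|].
rewrite S_INR; simpl. pose proof (pos_INR n).
assert ((1 - x) * (1 - INR n * x) <= (1 - x) * (1 - x) ^ n)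
  by (apply Rmult_le_compat_l; lra).
nra.
Qed.

Lemma pow_le_1_decr (r : R) (m n : nat) : 0 <= r <= 1 -> (m <= n)%nat -> r ^ n <= r ^ m.
Proof.
intros Hr Hmn; replace n with (m + (n - m))%nat by lia; rewrite pow_add.
rewrite <- (Rmult_1_r (r ^ m)) at 2; apply Rmult_le_compat_l; [now apply pow_le|].
rewrite <- (pow1 (n - m)); now apply pow_incr.
Qed.

Lemma analytic_ext (f g : C -> C) :
  (forall z, disk z -> f z = g z) -> analytic f -> analytic g.
Proof.
intros E Hf z Hz; exists (C_derive f z); apply C_is_deriveP; intros eps He.
destruct (proj1 (C_is_deriveP _ _ _) (C_derive_spec f z Hf Hz) eps He) as [d [Hd0 Hd]].
exists (Rmin d (1 - Cmod z)); split; [apply Rmin_pos; unfold disk in Hz; lra|].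
intros w Hw. rewrite <- !E; [|easy|].
- apply Hd; eapply Rlt_le_trans; [apply Hw|apply Rmin_l].
- unfold disk; replace w with (z + (w - z))%C by ring.
  eapply Rle_lt_trans; [apply Cmod_triangle|].
  pose proof (Rlt_le_trans _ _ _ Hw (Rmin_r _ _)); lra.
Qed.

Lemma analytic_plus (f g : C -> C) :
  analytic f -> analytic g -> analytic (fun z => f z + g z)%C.
Proof. intros Hf Hg z Hz; apply (ex_derive_plus (V := C_NormedModule)); auto. Qed.

Lemma analytic_minus_const (f : C -> C) (c : C) :
  analytic f -> analytic (fun z => f z - c)%C.
Proof.
intros Hf z Hz; apply (ex_derive_minus (V := C_NormedModule)); auto.
apply (ex_derive_const (V := C_NormedModule)).
Qed.

Lemma is_derive_minus_id (f : C -> C) (z l : C) :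
  is_derive (K := C_AbsRing) (V := C_NormedModule) f z l ->
  is_derive (K := C_AbsRing) (V := C_NormedModule) (fun w => f w - w)%C z (l - 1)%C.
Proof.
intros H; apply C_is_deriveP; intros eps He.
destruct (proj1 (C_is_deriveP _ _ _) H eps He) as [d [Hd0 Hd]].
exists d; split; [easy|intros w Hw].
replace (f w - w - (f z - z) - (w - z) * (l - 1))%C
  with (f w - f z - (w - z) * l)%C by ring; auto.
Qed.

(** * Monomial norms, and rigidity of a semigroup that moves monomials little *)

(** Pins [A n] down as the norm of [z^n] up to a factor two, through an upper bound that is more
    than half attained. *)
Record monomial_norms (v : C -> R) (A : nat -> R) : Prop := {
  monomial_norm_pos : forall n, 0 < A n;
  monomial_norm_ub : forall n z, disk z -> v z * Cmod z ^ n <= A n;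
  monomial_norm_near : forall n, exists z, disk z /\ A n / 2 < v z * Cmod z ^ n }.

Lemma disk_RtoC (x : R) : 0 <= x < 1 -> disk x.
Proof. intros Hx; unfold disk; rewrite Cmod_R, Rabs_pos_eq; lra. Qed.

Lemma weight_bound (v : C -> R) : weight v ->
  exists B, 0 < B /\ forall z, disk z -> v z <= B.
Proof.
intros [[B HB] _ Hp _]; exists B; split; [|easy].
assert (D : disk 0) by (apply disk_RtoC; lra).
specialize (HB 0 D); specialize (Hp 0 D); lra.
Qed.

Lemma monomial_norms_exist (v : C -> R) : weight v -> exists A, monomial_norms v A.
Proof.
intros Hv; destruct (weight_bound v Hv) as [B [HB0 HB]].
pose proof (weight_positive v Hv) as Hp.
assert (H : forall n, exists a, 0 < a /\ (forall z, disk z -> v z * Cmod z ^ n <= a) /\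
   exists z, disk z /\ a / 2 < v z * Cmod z ^ n).
{ intros n.
  assert (D : disk (/ 2)%R) by (apply disk_RtoC; lra).
  destruct (completeness (fun x => exists z, disk z /\ x = v z * Cmod z ^ n)) as [a [Ha1 Ha2]].
  - exists B; intros x [z [Hz ->]].
    assert (0 <= Cmod z ^ n <= 1).
    { pose proof (Cmod_ge_0 z); unfold disk in Hz.
      split; [now apply pow_le|].
      rewrite <- (pow1 n); apply pow_incr; lra. }
    specialize (HB z Hz); specialize (Hp z Hz); nra.
  - eexists; exists (/ 2)%R; split; [easy|reflexivity].
  - assert (Ha : 0 < a).
    { apply Rlt_le_trans with (v (/ 2)%R * Cmod (/ 2)%R ^ n).
      - apply Rmult_lt_0_compat; [now apply Hp|].
        rewrite Cmod_R, Rabs_pos_eq by lra; apply pow_lt; lra.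
      - apply Ha1; exists (/ 2)%R; auto. }
    exists a; split; [easy|]; split.
    + intros z Hz; apply Ha1; eauto.
    + apply NNPP; intros Hn.
      assert (a <= a / 2); [|lra].
      apply Ha2; intros x [z [Hz ->]]; apply Rnot_lt_le; intros Hlt; apply Hn; eauto. }
destruct (choice _ H) as [A HA]; exists A; split; intros n; apply HA.
Qed.

(** For [r < s < 1], [A n >= v(s) s^n], so [r^n / A n] is at most [(r/s)^n / v(s)], which tends to
    [0]. *)
Lemma pow_le_monomial_norm (v : C -> R) (A : nat -> R) (r eps : R) :
  weight v -> monomial_norms v A -> 0 <= r < 1 -> 0 < eps ->
  exists N, forall n, (N <= n)%nat -> r ^ n <= eps * A n.
Proof.
intros Hv HA Hr He.
set (s := (1 + r) / 2).
assert (Hs : r < s < 1) by (unfold s; lra).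
assert (D : disk s) by (apply disk_RtoC; lra).
pose proof (weight_positive v Hv s D) as Hvs.
destruct (pow_lt_1_zero (r / s)) with (y := eps * v s) as [N HN].
- rewrite Rabs_pos_eq; [apply Rlt_div_l; lra|apply Rle_div_r; lra].
- apply Rmult_lt_0_compat; easy.
- exists N; intros n Hn; specialize (HN n Hn).
  apply Rabs_lt_between in HN; destruct HN as [_ HN].
  pose proof (monomial_norm_ub v A HA n s D) as Hub.
  rewrite Cmod_R, Rabs_pos_eq in Hub by lra.
  assert (Hsn : 0 < s ^ n) by (apply pow_lt; lra).
  unfold Rdiv in HN; rewrite Rpow_mult_distr, pow_inv in HN.
  apply (Rmult_lt_compat_r (s ^ n)) in HN; [|easy].
  replace (r ^ n * / s ^ n * s ^ n) with (r ^ n) in HN by (field; lra).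
  nra.
Qed.

(** A time [t] is cut into [k] steps of length below [eps], each of which acts as the identity. *)
Lemma semigroup_id_of_small (phi : R -> C -> C) (eps : R) :
  analytic_semigroup phi -> 0 < eps ->
  (forall t z, 0 < t < eps -> disk z -> phi t z = z) ->
  forall t z, 0 <= t -> disk z -> phi t z = z.
Proof.
intros Hphi He Hid t z Ht Hz.
destruct (Req_dec t 0) as [->|Ht0]; [now apply (semigroup_id phi Hphi)|].
destruct (INR_unbounded (t / eps)) as [k Hk].
assert (Hk0 : 0 < INR k) by (eapply Rle_lt_trans; [|apply Hk]; apply Rle_div_r; lra).
assert (Hs : 0 < t / INR k < eps).
{ split; [apply Rdiv_lt_0_compat; lra|].
  apply Rlt_div_l in Hk; [|lra]. apply Rlt_div_l; lra. }
assert (H : forall j, phi (INR j * (t / INR k)) z = z).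
{ induction j as [|j IH].
  - simpl; rewrite Rmult_0_l; now apply (semigroup_id phi Hphi).
  - rewrite S_INR; replace ((INR j + 1) * (t / INR k)) with (t / INR k + INR j * (t / INR k)) by ring.
    pose proof (pos_INR j).
    rewrite (semigroup_comp phi Hphi), IH; [apply Hid|..]; try easy; try lra.
    apply Rmult_le_pos; lra. }
rewrite <- (H k) at 2. f_equal; field; lra.
Qed.

(** Shows [|psi z0 - z0| <= 1/M] for every [M], by proving it on a circle around the origin that
    encloses [z0]. *)
Lemma eq_id_of_weighted_powers (v : C -> R) (A : nat -> R) (N : nat) (psi : C -> C) :
  weight v -> monomial_norms v A ->
  analytic psi -> analytic (C_derive psi) ->
  (forall n p z, (N <= n <= p)%nat -> disk z ->
     v z * Cmod (C_derive psi z * psi z ^ p - z ^ p) <= A n / 16) ->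
  forall z, disk z -> psi z = z.
Proof.
intros Hv HA Hpsi Hpsi' H z0 Hz0.
assert (Hb : forall M, INR M * Cmod (psi z0 - z0) <= 1).
{ intros M; destruct (Nat.eq_dec M 0) as [->|HM]; [simpl; lra|].
  assert (HM1 : 1 <= INR M) by (apply (le_INR 1); lia).
  assert (Hx : 0 < / (2 * INR M) <= / 2).
  { split; [apply Rinv_0_lt_compat; lra|apply Rinv_le_contravar; lra]. }
  (* Beyond [R0] a circle encloses [z0] and, by Bernoulli, has [r^M >= 1/2]. *)
  set (R0 := Rmax (1 - / (2 * INR M)) (Cmod z0)).
  assert (HR0 : 0 <= R0 < 1).
  { unfold R0; split.
    - eapply Rle_trans; [|apply Rmax_r]; apply Cmod_ge_0.
    - apply Rmax_lub_lt; [lra|exact Hz0]. }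
  destruct (weight_bound v Hv) as [B [HB0 HB]].
  (* With this constant, [v z |z|^n <= A n / 2] whenever [|z| <= R0], so a point nearly attaining
     [A n] must lie beyond [R0]. *)
  destruct (pow_le_monomial_norm v A R0 (/ (2 * B)) Hv HA HR0) as [N1 HN1];
    [apply Rinv_0_lt_compat; lra|].
  set (n := Nat.max N N1).
  destruct (monomial_norm_near v A HA n) as [z1 [Hz1 Hn]].
  set (r := Cmod z1) in *.
  assert (Hr1 : r < 1) by exact Hz1.
  assert (HRr : R0 < r).
  { apply Rnot_le_lt; intros Hle.
    assert (r ^ n <= R0 ^ n) by (apply pow_incr; split; [apply Cmod_ge_0|easy]).
    specialize (HN1 n (Nat.le_max_r _ _)).
    assert (B * R0 ^ n <= A n / 2).
    { apply (Rmult_le_compat_l B) in HN1; [|lra].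
      replace (B * (/ (2 * B) * A n)) with (A n / 2) in HN1 by (field; lra). easy. }
    assert (0 <= r ^ n) by (apply pow_le, Cmod_ge_0).
    specialize (HB z1 Hz1); pose proof (weight_positive v Hv z1 Hz1); nra. }
  assert (Hrpos : 0 < r) by lra.
  assert (HrM : / 2 <= r ^ M).
  { apply Rle_trans with ((1 - / (2 * INR M)) ^ M).
    - eapply Rle_trans; [|apply Bernoulli_minus; lra].
      apply Req_le; field; lra.
    - apply pow_incr; split; [lra|].
      pose proof (Rmax_l (1 - / (2 * INR M)) (Cmod z0)); fold R0 in H0; lra. }
  assert (Hcirc : forall z, Cmod z = r -> Cmod (psi z - z) <= / INR M).
  { intros z Hz.
    assert (Dz : disk z) by (unfold disk; lra).
    assert (Hz00 : z <> 0) by (intros ->; rewrite Cmod_0 in Hz; lra).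
    (* Dividing the hypothesis by [v r^n > A n / 2] leaves [|G q^m - 1| r^m <= 1/8]. The case
       [m = 0] gives [|G| >= 7/8], and [r^m >= 1/2] then gives [|q^m - 1| <= 3/7]. *)
    set (q := (psi z / z)%C).
    set (G := (C_derive psi z * q ^ n)%C).
    assert (HG : forall m, Cmod (G * q ^ m - 1) * r ^ m <= / 8).
    { intros m. specialize (H n (n + m)%nat z ltac:(unfold n; lia) Dz).
      rewrite (weight_radial v Hv z z1) in H by easy.
      replace (C_derive psi z * psi z ^ (n + m) - z ^ (n + m))%C
        with ((G * q ^ m - 1) * z ^ (n + m))%C in H.
      - rewrite Cmod_mult, Cmod_pow, Hz, pow_add in H.
        assert (0 < r ^ n) by now apply pow_lt.
        pose proof (weight_positive v Hv z1 Hz1) as Hvz.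
        apply Rmult_le_reg_l with (v z1 * r ^ n); [now apply Rmult_lt_0_compat|].
        lra.
      - unfold G; rewrite <- Cmult_assoc, <- Cpow_add_r.
        replace (psi z) with (q * z)%C by (unfold q; field; easy).
        rewrite Cpow_mult_l; ring. }
    assert (HG0 : Cmod (G - 1) <= / 8).
    { specialize (HG O); simpl in HG; rewrite Cmult_1_r, Rmult_1_r in HG; easy. }
    assert (HGq : 7 / 8 <= Cmod G).
    { pose proof (Cmod_triangle G (- (G - 1))) as Ht.
      replace (G + - (G - 1))%C with (RtoC 1) in Ht by ring.
      rewrite Cmod_1, Cmod_opp in Ht; lra. }
    assert (Hq : INR M * Cmod (q - 1) <= 1).
    { apply powers_near_1; intros m Hm.
      assert (Hrm : / 2 <= r ^ m).
      { eapply Rle_trans; [apply HrM|apply pow_le_1_decr]; [lra|easy]. }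
      specialize (HG m).
      pose proof (Cmod_ge_0 (G * q ^ m - 1)).
      assert (Hsum : Cmod G * Cmod (q ^ m - 1) <= 3 / 8).
      { rewrite <- Cmod_mult.
        replace (G * (q ^ m - 1))%C with ((G * q ^ m - 1) + - (G - 1))%C by ring.
        eapply Rle_trans; [apply Cmod_triangle|]. rewrite Cmod_opp. nra. }
      pose proof (Cmod_ge_0 (q ^ m - 1)); nra. }
    replace (psi z - z)%C with (z * (q - 1))%C by (unfold q; field; easy).
    rewrite Cmod_mult, Hz.
    apply Rmult_le_reg_l with (INR M); [lra|]. rewrite Rinv_r by lra.
    pose proof (Cmod_ge_0 (q - 1)); nra. }
  apply Rmult_le_reg_l with (/ INR M); [apply Rinv_0_lt_compat; lra|].
  rewrite <- Rmult_assoc, Rinv_l, Rmult_1_l, Rmult_1_r by lra.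
  apply (maximum_principle (fun z => psi z - z)%C r); try easy.
  - intros z Hz; eexists; now apply is_derive_minus_id, C_derive_spec.
  - apply (analytic_ext (fun z => C_derive psi z - 1)%C).
    + intros z Hz; symmetry; apply is_C_derive_unique, is_derive_minus_id.
      now apply C_derive_spec.
    + now apply analytic_minus_const.
  - pose proof (Rmax_r (1 - / (2 * INR M)) (Cmod z0)); fold R0 in H0; lra. }
assert (E : Cmod (psi z0 - z0) = 0).
{ apply NNPP; intros Hne.
  pose proof (Cmod_ge_0 (psi z0 - z0)).
  destruct (INR_unbounded (/ Cmod (psi z0 - z0))) as [M HM].
  specialize (Hb M).
  assert (/ Cmod (psi z0 - z0) * Cmod (psi z0 - z0) = 1) by (field; lra).
  nra. }
apply Cmod_eq_0 in E.
replace (psi z0) with ((psi z0 - z0) + z0)%C by ring; rewrite E; ring.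
Qed.

Lemma far_monomial_exists (v : C -> R) (A : nat -> R) (phi : R -> C -> C) :
  weight v -> monomial_norms v A ->
  analytic_semigroup phi -> nontrivial_semigroup phi ->
  (forall t, 0 <= t -> analytic (C_derive (phi t))) ->
  forall eps N, 0 < eps -> exists t n p z,
    0 < t < eps /\ (N <= n <= p)%nat /\ disk z /\
    A n / 16 < v z * Cmod (C_derive (phi t) z * phi t z ^ p - z ^ p).
Proof.
intros Hv HA Hphi [t0 [Ht0 [z0 [Hz0 Hne]]]] Hd eps N He; apply NNPP; intros Hn.
apply Hne; apply (semigroup_id_of_small phi eps); try easy.
intros t z Ht Hz.
apply (eq_id_of_weighted_powers v A N); try easy.
- apply (semigroup_analytic phi Hphi); lra.
- apply Hd; lra.
- intros n p w Hnp Hw; apply Rnot_lt_le; intros Hlt; apply Hn.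
  exists t, n, p, w; auto.
Qed.

(** * Analyticity of series of monomials *)

(** Cauchy-type estimates whose only dependence on [p] is the factor [(r + d)^p], so that they can
    be summed over a series. The three go through induction together, since
    [r X + d X = (r + d) X]. *)
Lemma Cpow_expansion (z w : C) (r d : R) (p : nat) :
  0 < d -> Cmod z <= r -> Cmod w <= r ->
  Cmod (w ^ p - z ^ p) <= Cmod (w - z) * ((r + d) ^ p / d) /\
  Cmod (INR p * z ^ pred p) <= (r + d) ^ p / d /\
  Cmod (w ^ p - z ^ p - (w - z) * (INR p * z ^ pred p)) <=
    Cmod (w - z) ^ 2 * ((r + d) ^ p / d ^ 2).
Proof.
intros Hd Hz Hw.
pose proof (Cmod_ge_0 z) as Hz0; pose proof (Cmod_ge_0 (w - z)) as Hwz.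
induction p as [|p [IH1 [IH2 IH3]]].
- replace (w ^ 0 - z ^ 0)%C with (RtoC 0) by (simpl; ring).
  replace (INR 0 * z ^ pred 0)%C with (RtoC 0) by (simpl; ring).
  replace (0 - (w - z) * 0)%C with (RtoC 0) by ring.
  rewrite Cmod_0; simpl (_ ^ 0).
  assert (0 < 1 / d) by (apply Rdiv_lt_0_compat; lra).
  assert (0 < 1 / d ^ 2) by (apply Rdiv_lt_0_compat; [lra|now apply pow_lt]).
  repeat split; try nra.
- set (D := (INR p * z ^ pred p)%C) in *.
  assert (Hzp : Cmod (z ^ p) <= (r + d) ^ p) by (rewrite Cmod_pow; apply pow_incr; lra).
  assert (Hrp : 0 <= (r + d) ^ p) by (apply pow_le; lra).
  (* The case [p = 0] is separate because [pred 0] is [0]; the coefficient [INR 0] then cancels the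
     spurious term. *)
  assert (ED : (INR (S p) * z ^ pred (S p) = z * D + z ^ p)%C).
  { unfold D; rewrite S_INR, RtoC_plus; destruct p; simpl; ring. }
  rewrite ED.
  assert (E1 : r * ((r + d) ^ p / d) + (r + d) ^ p = (r + d) ^ S p / d)
    by (simpl; field; lra).
  assert (E2 : r * ((r + d) ^ p / d ^ 2) + (r + d) ^ p / d = (r + d) ^ S p / d ^ 2)
    by (simpl; field; lra).
  rewrite <- E1, <- E2.
  replace (w ^ S p - z ^ S p - (w - z) * (z * D + z ^ p))%C
    with (z * (w ^ p - z ^ p - (w - z) * D) + (w - z) * (w ^ p - z ^ p))%C by (simpl; ring).
  replace (w ^ S p - z ^ S p)%C with (w * (w ^ p - z ^ p) + (w - z) * z ^ p)%C
    by (simpl; ring).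
  repeat split; (eapply Rle_trans; [apply Cmod_triangle|]); rewrite ?Cmod_mult.
  + assert (Cmod w * Cmod (w ^ p - z ^ p) <= r * (Cmod (w - z) * ((r + d) ^ p / d)))
      by (apply Rmult_le_compat; try apply Cmod_ge_0; easy).
    nra.
  + assert (Cmod z * Cmod D <= r * ((r + d) ^ p / d))
      by (apply Rmult_le_compat; try apply Cmod_ge_0; easy).
    lra.
  + assert (Cmod z * Cmod (w ^ p - z ^ p - (w - z) * D) <=
      r * (Cmod (w - z) ^ 2 * ((r + d) ^ p / d ^ 2)))
      by (apply Rmult_le_compat; try apply Cmod_ge_0; easy).
    assert (Cmod (w - z) * Cmod (w ^ p - z ^ p) <=
      Cmod (w - z) * (Cmod (w - z) * ((r + d) ^ p / d)))
      by (apply Rmult_le_compat_l; easy).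
    nra.
Qed.

Lemma analytic_of_quadratic_remainder (f : C -> C) :
  (forall z, disk z -> exists l d M, 0 < d /\ forall w, Cmod (w - z) < d ->
     Cmod (f w - f z - (w - z) * l) <= M * Cmod (w - z) ^ 2) ->
  analytic f.
Proof.
intros H z Hz; destruct (H z Hz) as [l [d [M [Hd Hw]]]].
exists l; apply C_is_deriveP; intros eps He.
pose proof (Rabs_pos M); pose proof (Rle_abs M).
exists (Rmin d (eps / (Rabs M + 1))); split.
- apply Rmin_pos; [easy|apply Rdiv_lt_0_compat; lra].
- intros w Hwz.
  eapply Rle_trans; [apply Hw, (Rlt_le_trans _ _ _ Hwz (Rmin_l _ _))|].
  pose proof (Rlt_le_trans _ _ _ Hwz (Rmin_r _ _)) as Hw2.
  apply Rlt_div_r in Hw2; [|lra].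
  pose proof (Cmod_ge_0 (w - z)).
  assert (M * Cmod (w - z) <= eps) by nra. simpl; nra.
Qed.

Lemma analytic_monomial (a : R) (p : nat) : analytic (fun z => a * z ^ p)%C.
Proof.
apply analytic_of_quadratic_remainder; intros z Hz.
exists (a * (INR p * z ^ pred p))%C, 1, (Rabs a * ((Cmod z + 1 + 1) ^ p / 1 ^ 2)).
split; [lra|intros w Hw].
replace (a * w ^ p - a * z ^ p - (w - z) * (a * (INR p * z ^ pred p)))%C
  with (a * (w ^ p - z ^ p - (w - z) * (INR p * z ^ pred p)))%C by ring.
rewrite Cmod_mult, Cmod_R, Rmult_assoc; apply Rmult_le_compat_l; [apply Rabs_pos|].
rewrite Rmult_comm; apply Cpow_expansion; [lra|lra|].
replace w with (z + (w - z))%C by ring.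
eapply Rle_trans; [apply Cmod_triangle|lra].
Qed.

Lemma is_series_Cmod_le (b : nat -> C) (m : nat -> R) (l : C) (s : R) :
  is_series (K := C_AbsRing) (V := C_NormedModule) b l ->
  (forall k, Cmod (b k) <= m k) -> is_series m s -> Cmod l <= s.
Proof.
intros Hb Hbm Hm.
apply (is_lim_seq_le (fun n => Cmod (sum_n (G := C_NormedModule) b n)) (sum_n m) (Cmod l) s).
- intros n; eapply Rle_trans; [apply (norm_sum_n_m (V := C_NormedModule))|].
  apply sum_n_m_le; exact Hbm.
- eapply filterlim_comp; [apply Hb|apply (filterlim_norm (V := C_NormedModule))].
- exact Hm.
Qed.

(** Here [S k] sums the terms of index below [k]. It is given by its recurrence because it will be
    the [partial] of a stage. *)
Lemma is_series_tail (b S : nat -> C) (l : C) :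
  is_series (K := C_AbsRing) (V := C_NormedModule) b l ->
  S O = 0 -> (forall k, S (k + 1)%nat = (S k + b k)%C) ->
  forall k, is_series (K := C_AbsRing) (V := C_NormedModule)
    (fun j => b (k + j)%nat) (l - S k)%C.
Proof.
intros Hb HS0 HS; induction k as [|k IH].
- rewrite HS0; replace (l - 0)%C with l by ring; exact Hb.
- apply (is_series_ext (V := C_NormedModule) (fun j => b (k + Datatypes.S j)%nat)).
  { intros j; f_equal; lia. }
  apply (is_series_incr_1 (V := C_NormedModule) (fun j => b (k + j)%nat)).
  replace (Datatypes.S k) with (k + 1)%nat by lia; rewrite HS, Nat.add_0_r.
  change (plus (l - (S k + b k))%C (b k)) with (l - (S k + b k) + b k)%C.
  replace (l - (S k + b k) + b k)%C with (l - S k)%C by ring; exact IH.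
Qed.

Lemma is_series_half : is_series (fun k => (/ 2) ^ k) 2.
Proof.
assert (E : / (1 - / 2) = 2) by field.
pose proof (is_series_geom (/ 2)) as H; rewrite E in H.
apply H; rewrite Rabs_pos_eq; lra.
Qed.

Lemma is_series_tail_le (b S : nat -> C) (l : C) (k : nat) (c : R) :
  is_series (K := C_AbsRing) (V := C_NormedModule) b l ->
  S O = 0 -> (forall k, S (k + 1)%nat = (S k + b k)%C) ->
  (forall j, Cmod (b (k + j)%nat) <= c * (/ 2) ^ j) ->
  Cmod (l - S k) <= c * 2.
Proof.
intros Hb HS0 HS Hc.
apply (is_series_Cmod_le _ _ _ _ (is_series_tail b S l Hb HS0 HS k) Hc).
apply (is_series_scal (V := R_NormedModule) c (fun j => (/ 2) ^ j) 2), is_series_half.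
Qed.

(** The termwise derivatives converge and the quadratic remainders add up, both being dominated by
    the series at [r + d < 1]. *)
Lemma analytic_series (a : nat -> R) (p : nat -> nat) (f : C -> C) :
  (forall k, 0 <= a k) ->
  (forall r, 0 <= r < 1 -> ex_series (fun k => a k * r ^ p k)) ->
  (forall z, disk z -> is_series (K := C_AbsRing) (V := C_NormedModule)
     (fun k => a k * z ^ p k)%C (f z)) ->
  analytic f.
Proof.
intros Ha Hr Hf; apply analytic_of_quadratic_remainder; intros z Hz.
pose proof (Cmod_ge_0 z) as Hz0; unfold disk in Hz.
(* A third of the distance to the boundary leaves room for [w] within [d] of [z] and for a second
   margin [d] in the estimates. *)
set (d := (1 - Cmod z) / 3).
set (r := Cmod z + d).
assert (Hd : 0 < d) by (unfold d; lra).
assert (Hrd : 0 <= r + d < 1) by (unfold r, d; lra).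
destruct (Hr _ Hrd) as [M HM].
destruct (ex_series_le (K := C_AbsRing) (V := C_CompleteNormedModule)
  (fun k => a k * (INR (p k) * z ^ pred (p k)))%C
  (fun k => / d * (a k * (r + d) ^ p k))) as [l Hl].
- intros k; change (norm (a k * (INR (p k) * z ^ pred (p k)))%C)
    with (Cmod (a k * (INR (p k) * z ^ pred (p k)))).
  rewrite Cmod_mult, Cmod_R, Rabs_pos_eq by auto.
  replace (/ d * (a k * (r + d) ^ p k)) with (a k * ((r + d) ^ p k / d)) by (field; lra).
  apply Rmult_le_compat_l; [auto|].
  apply (Cpow_expansion z z r d (p k)); unfold r; lra.
- apply (ex_series_scal (V := R_NormedModule) (/ d)); exists M; exact HM.
- exists l, d, (M / d ^ 2); split; [easy|intros w Hw].
  assert (Hwr : Cmod w <= r).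
  { replace w with (z + (w - z))%C by ring.
    eapply Rle_trans; [apply Cmod_triangle|unfold r; lra]. }
  apply (is_series_Cmod_le
    (fun k => a k * w ^ p k - a k * z ^ p k - (w - z) * (a k * (INR (p k) * z ^ pred (p k))))%C
    (fun k => Cmod (w - z) ^ 2 / d ^ 2 * (a k * (r + d) ^ p k))).
  + apply (is_series_minus (V := C_NormedModule)
      (fun k => a k * w ^ p k - a k * z ^ p k)%C
      (fun k => (w - z) * (a k * (INR (p k) * z ^ pred (p k))))%C).
    * apply (is_series_minus (V := C_NormedModule)
        (fun k => a k * w ^ p k)%C (fun k => a k * z ^ p k)%C); apply Hf; unfold disk; lra.
    * apply (is_series_scal (K := C_AbsRing) (V := C_NormedModule) (w - z)%C); exact Hl.
  + intros k.
    replace (a k * w ^ p k - a k * z ^ p k - (w - z) * (a k * (INR (p k) * z ^ pred (p k))))%C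
      with (a k * (w ^ p k - z ^ p k - (w - z) * (INR (p k) * z ^ pred (p k))))%C by ring.
    rewrite Cmod_mult, Cmod_R, Rabs_pos_eq by auto.
    replace (Cmod (w - z) ^ 2 / d ^ 2 * (a k * (r + d) ^ p k))
      with (a k * (Cmod (w - z) ^ 2 * ((r + d) ^ p k / d ^ 2))) by (field; lra).
    apply Rmult_le_compat_l; [auto|].
    apply Cpow_expansion; unfold r in *; lra.
  + replace (M / d ^ 2 * Cmod (w - z) ^ 2) with (Cmod (w - z) ^ 2 / d ^ 2 * M)
      by (field; lra).
    apply (is_series_scal (V := R_NormedModule) (Cmod (w - z) ^ 2 / d ^ 2) _ M); exact HM.
Qed.

(** * Pointwise form of the weighted norms *)

Lemma wnorm_lt_bound (v : C -> R) (f : C -> C) (e : R) : Rbar_lt (wnorm v f) e ->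
  forall z, disk z -> v z * Cmod (f z) < e.
Proof.
intros H z Hz; unfold wnorm in H.
destruct (Lub_Rbar_correct (fun x => exists z, disk z /\ x = v z * Cmod (f z))) as [Hub _].
apply (Rbar_le_lt_trans _ _ (Finite e) (Hub _ (ex_intro _ z (conj Hz eq_refl))) H).
Qed.

Lemma Hinf_of_bound (v : C -> R) (f : C -> C) (M : R) : analytic f ->
  (forall z, disk z -> v z * Cmod (f z) <= M) -> Hinf v f.
Proof.
intros Hf HM; split; [easy|]; unfold wnorm.
destruct (Lub_Rbar_correct (fun x => exists z, disk z /\ x = v z * Cmod (f z))) as [_ Hle].
apply (Rbar_le_lt_trans _ (Finite M)); [|easy].
apply Hle; intros x [z [Hz ->]]; exact (HM z Hz).
Qed.

Lemma Hinf_of_bounded (v : C -> R) (f : C -> C) (M : R) : weight v -> analytic f ->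
  (forall z, disk z -> Cmod (f z) <= M) -> Hinf v f.
Proof.
intros Hv Hf HM; destruct (weight_bound v Hv) as [B [HB0 HB]].
apply (Hinf_of_bound v f (B * M)); [easy|intros z Hz].
apply Rmult_le_compat; auto; [|apply Cmod_ge_0].
apply Rlt_le, (weight_positive v Hv z Hz).
Qed.

Lemma cont_space_bound (phi : R -> C -> C) (v : C -> R) (f : C -> C) (e : R) :
  cont_space phi v f -> 0 < e -> exists d, 0 < d /\ forall t z, 0 < t < d -> disk z ->
    v z * Cmod (wcomp phi t f z - f z) < e.
Proof.
intros [_ H] He; destruct (H (mkposreal e He)) as [d Hd].
exists d; split; [apply cond_pos|intros t z Ht Hz].
apply (wnorm_lt_bound v (fun z => wcomp phi t f z - f z)%C e); [|easy].
apply (Hd t); [|lra].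
unfold ball; simpl; unfold AbsRing_ball, abs, minus, plus, opp; simpl.
rewrite Rabs_pos_eq; lra.
Qed.

(** * The gliding hump *)

(* [partial] is the sum of the monomials chosen so far and [mass] the sum of their
   coefficients; [coef], [expo], [time], [point] belong to the last one. *)
Record stage := Stage {
  partial : C -> C; mass : R; radius : R; gain : R;
  coef : R; expo : nat; time : R; point : C }.

(** Past [radius] the weight is small enough for the current sum to have weighted size at most
    [1]. *)
Record admissible (v : C -> R) (s : stage) : Prop := {
  adm_analytic : analytic (partial s);
  adm_mass : forall w, disk w -> Cmod (partial s w) <= mass s;
  adm_radius : 0 <= radius s < 1;
  adm_gain : 1 <= gain s;
  adm_outside : forall w, disk w -> radius s <= Cmod w -> v w * mass s <= 1 }.

(** The new monomial is tiny on the old disk, has norm at most [1], and is moved by more than [1/16]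
    at [point], where the old sum moves by at most [1/64]. There [gain] bounds the factor by which
    the operator can amplify the error made by omitting later monomials. *)
Record next_stage (v : C -> R) (phi : R -> C -> C) (k : nat) (s s' : stage) : Prop := {
  next_coef : 0 <= coef s';
  next_partial : forall w, partial s' w = (partial s w + coef s' * w ^ expo s')%C;
  next_radius : radius s <= radius s';
  next_radius_large : 1 - (/ 2) ^ k <= radius s';
  next_gain : gain s <= gain s';
  next_small : coef s' * radius s ^ expo s' <= (/ 2) ^ k / (128 * gain s);
  next_norm : forall w, disk w -> v w * (coef s' * Cmod w ^ expo s') <= 1;
  next_time : 0 < time s' < (/ 2) ^ k;
  next_point : disk (point s');
  next_point_radius : Cmod (point s') <= radius s';
  next_image_radius : Cmod (phi (time s') (point s')) <= radius s';
  next_old : v (point s') *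
    Cmod (wcomp phi (time s') (partial s) (point s') - partial s (point s')) <= / 64;
  next_new : / 16 < v (point s') * (coef s' *
    Cmod (C_derive (phi (time s')) (point s') * phi (time s') (point s') ^ expo s'
          - point s' ^ expo s'));
  next_gain_large : v (point s') * (1 + Cmod (C_derive (phi (time s')) (point s')))
    <= gain s' }.

Lemma typical_radius (v : C -> R) (c : R) : typical v -> 0 <= c ->
  exists r, r < 1 /\ forall w, disk w -> r <= Cmod w -> v w * c <= 1.
Proof.
intros Ht Hc; assert (He : 0 < / (c + 1)) by (apply Rinv_0_lt_compat; lra).
destruct (Ht (mkposreal _ He)) as [r [Hr H]]; simpl in H.
(* The midpoint turns the strict inequality in [typical] into a weak one. *)
exists ((1 + r) / 2); split; [lra|intros w Hw Hrw].
specialize (H w ltac:(lra) Hw).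
pose proof (Rle_abs (v w)).
assert (v w * (c + 1) <= / (c + 1) * (c + 1)) by (apply Rmult_le_compat_r; lra).
rewrite Rinv_l in H1 by lra.
assert (/ (c + 1) * (c + 1) = 1) by (field; lra).
destruct (Rle_dec 0 (v w)); nra.
Qed.

(** First [d] controls the old sum and [N] the size on the old disk; then a far monomial [z^p]
    supplies the time and the point, with coefficient [/ A n]; the new radius and gain come last, as
    they depend on all of these. *)
Lemma next_stage_exists (v : C -> R) (A : nat -> R) (phi : R -> C -> C) :
  weight v -> typical v -> monomial_norms v A ->
  analytic_semigroup phi -> nontrivial_semigroup phi ->
  (forall t, 0 <= t -> analytic (C_derive (phi t))) ->
  (forall f, Hinf v f -> cont_space phi v f) ->
  forall k s, admissible v s -> exists s', admissible v s' /\ next_stage v phi k s s'.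
Proof.
intros Hv Ht HA Hphi Hnt Hd Hcont k s Hs.
destruct Hs as [Han Hmass Hrad Hgain Hout].
assert (Hk : 0 < (/ 2) ^ k) by (apply pow_lt; lra).
destruct (cont_space_bound phi v (partial s) (/ 64)) as [d [Hd0 Hdz]]; [|lra|].
{ apply Hcont; apply (Hinf_of_bounded v _ (mass s)); easy. }
destruct (pow_le_monomial_norm v A (radius s) ((/ 2) ^ k / (128 * gain s)) Hv HA Hrad)
  as [N HN]; [apply Rdiv_lt_0_compat; lra|].
destruct (far_monomial_exists v A phi Hv HA Hphi Hnt Hd (Rmin d ((/ 2) ^ k)) N)
  as [t [n [p [z [Htt [Hnp [Hz Hfar]]]]]]]; [now apply Rmin_pos|].
pose proof (Rmin_l d ((/ 2) ^ k)); pose proof (Rmin_r d ((/ 2) ^ k)).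
pose proof (monomial_norm_pos v A HA n) as HAn.
assert (Ha : 0 < / A n) by now apply Rinv_0_lt_compat.
assert (Hmass0 : 0 <= mass s).
{ eapply Rle_trans; [apply Cmod_ge_0|apply (Hmass z Hz)]. }
destruct (typical_radius v (mass s + / A n) Ht) as [r [Hr Hrv]]; [lra|].
assert (Hpz : disk (phi t z)) by (apply (semigroup_self_map phi Hphi); [lra|easy]).
set (R' := Rmax (Rmax (radius s) (1 - (/ 2) ^ k)) (Rmax r (Rmax (Cmod z) (Cmod (phi t z))))).
assert (HR1 : radius s <= R') by (unfold R'; eapply Rle_trans; [apply Rmax_l|apply Rmax_l]).
assert (HR2 : 1 - (/ 2) ^ k <= R') by (unfold R'; eapply Rle_trans; [apply Rmax_r|apply Rmax_l]).
assert (HR3 : Rmax r (Rmax (Cmod z) (Cmod (phi t z))) <= R') by apply Rmax_r.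
pose proof (Rmax_l r (Rmax (Cmod z) (Cmod (phi t z)))).
pose proof (Rmax_r r (Rmax (Cmod z) (Cmod (phi t z)))).
pose proof (Rmax_l (Cmod z) (Cmod (phi t z))).
pose proof (Rmax_r (Cmod z) (Cmod (phi t z))).
assert (HR : R' < 1) by (unfold R'; unfold disk in *; repeat apply Rmax_lub_lt; lra).
(* As [n <= p], bounds known for the exponent [n] pass to the exponent [p]. *)
assert (Hpow : forall x, 0 <= x <= 1 -> / A n * x ^ p <= / A n * x ^ n).
{ intros x Hx; apply Rmult_le_compat_l; [lra|apply pow_le_1_decr; [easy|lia]]. }
exists (Stage (fun w => partial s w + (/ A n)%R * w ^ p)%C (mass s + / A n) R'
  (Rmax (gain s) (v z * (1 + Cmod (C_derive (phi t) z)))) (/ A n) p t z).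
split; constructor; simpl; try lra; try easy.
- apply analytic_plus; [easy|apply analytic_monomial].
- intros w Hw; eapply Rle_trans; [apply Cmod_triangle|].
  apply Rplus_le_compat; [auto|].
  rewrite Cmod_mult, Cmod_R, Cmod_pow, Rabs_pos_eq by lra.
  rewrite <- (Rmult_1_r (/ A n)) at 2; apply Rmult_le_compat_l; [lra|].
  rewrite <- (pow1 p); apply pow_incr; split; [apply Cmod_ge_0|apply Rlt_le, Hw].
- eapply Rle_trans; [exact Hgain|apply Rmax_l].
- intros w Hw HRw; apply Hrv; [easy|lra].
- apply Rmax_l.
- eapply Rle_trans; [apply Hpow; lra|].
  specialize (HN n ltac:(lia)).
  apply Rmult_le_reg_l with (A n); [easy|].
  rewrite <- Rmult_assoc, Rinv_r, Rmult_1_l by lra; lra.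
- intros w Hw; pose proof (weight_positive v Hv w Hw).
  eapply Rle_trans.
  + apply Rmult_le_compat_l; [lra|]. apply Hpow; split; [apply Cmod_ge_0|apply Rlt_le, Hw].
  + pose proof (monomial_norm_ub v A HA n w Hw).
    apply Rmult_le_reg_l with (A n); [easy|].
    replace (A n * (v w * (/ A n * Cmod w ^ n))) with (v w * Cmod w ^ n) by (field; lra).
    lra.
- apply Rlt_le, Hdz; [lra|easy].
- apply Rmult_lt_reg_l with (A n); [easy|].
  match goal with |- _ < A n * (v z * (/ A n * ?x)) =>
    replace (A n * (v z * (/ A n * x))) with (v z * x) by (field; lra) end.
  lra.
- apply Rmax_r.
Qed.

Lemma indexed_dependent_choice (T : Type) (good : T -> Prop) (next : nat -> T -> T -> Prop)
  (x0 : T) : good x0 ->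
  (forall k x, good x -> exists y, good y /\ next k x y) ->
  exists u : nat -> T, u O = x0 /\ forall k, good (u k) /\ next k (u k) (u (k + 1)%nat).
Proof.
intros H0 H.
assert (H' : forall kx : nat * T, exists y, good (snd kx) ->
  good y /\ next (fst kx) (snd kx) y).
{ intros [k x]; destruct (classic (good x)) as [Hx|Hx].
  - destruct (H k x Hx) as [y Hy]; exists y; auto.
  - exists x; simpl; tauto. }
destruct (choice _ H') as [g Hg].
set (u := nat_rect (fun _ => T) x0 (fun k x => g (k, x))).
assert (Hu : forall k, good (u k)).
{ induction k as [|k IH]; [exact H0|]. exact (proj1 (Hg (k, u k) IH)). }
exists u; split; [reflexivity|intros k; split; [apply Hu|]].
rewrite Nat.add_1_r; exact (proj2 (Hg (k, u k) (Hu k))).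
Qed.

(** The sum [f] of all chosen monomials lies in the space, yet at the [k]-th time and point the
    [k]-th hump moves too much for the other terms to compensate. *)
Lemma exists_discontinuous_orbit (v : C -> R) (phi : R -> C -> C) :
  weight v -> typical v ->
  analytic_semigroup phi -> nontrivial_semigroup phi ->
  (forall t, 0 <= t -> analytic (C_derive (phi t))) ->
  ~ forall f, Hinf v f -> cont_space phi v f.
Proof.
intros Hv Ht Hphi Hnt Hd Hcont.
destruct (monomial_norms_exist v Hv) as [A HA].
destruct (indexed_dependent_choice stage (admissible v) (next_stage v phi)
  (Stage (fun _ => 0) 0 0 1 0 0 0 0)) as [u [Hu0 Hu]].
{ constructor; simpl; try lra.
  - intros z Hz; apply (ex_derive_const (V := C_NormedModule)).
  - intros w _; rewrite Cmod_0; lra.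
  - intros; lra. }
{ apply (next_stage_exists v A phi); easy. }
(* Stage [k + 1] carries the monomial added to the sum of stage [k], hence the shift. *)
set (a := fun k => coef (u (k + 1)%nat)).
set (p := fun k => expo (u (k + 1)%nat)).
set (r := fun k => radius (u k)).
set (b := fun (w : C) (k : nat) => (a k * w ^ p k)%C).
assert (Hadm : forall k, admissible v (u k)) by apply Hu.
assert (Hnext : forall k, next_stage v phi k (u k) (u (k + 1)%nat)) by apply Hu.
assert (Ha : forall k, 0 <= a k) by (intros k; exact (next_coef _ _ _ _ _ (Hnext k))).
assert (Hr : forall k, 0 <= r k < 1) by (intros k; exact (adm_radius _ _ (Hadm k))).
assert (Hrg : forall k j, r k <= r (k + j)%nat /\ gain (u k) <= gain (u (k + j)%nat)).
{ intros k; induction j as [|j IH].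
  - rewrite Nat.add_0_r; lra.
  - replace (k + S j)%nat with (k + j + 1)%nat by lia.
    pose proof (next_radius _ _ _ _ _ (Hnext (k + j)%nat)).
    pose proof (next_gain _ _ _ _ _ (Hnext (k + j)%nat)).
    unfold r in *; lra. }
assert (Hterm : forall k j x, 0 <= x <= r k ->
  a (k + j)%nat * x ^ p (k + j)%nat <= (/ 2) ^ k / (128 * gain (u k)) * (/ 2) ^ j).
{ intros k j x Hx; destruct (Hrg k j) as [H1 H2].
  pose proof (next_small _ _ _ _ _ (Hnext (k + j)%nat)) as H3.
  pose proof (adm_gain _ _ (Hadm k)) as H4.
  apply Rle_trans with (a (k + j)%nat * r (k + j)%nat ^ p (k + j)%nat).
  { apply Rmult_le_compat_l; [apply Ha|apply pow_incr; lra]. }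
  eapply Rle_trans; [exact H3|]. rewrite pow_add.
  replace ((/ 2) ^ k / (128 * gain (u k)) * (/ 2) ^ j)
    with ((/ 2) ^ k * (/ 2) ^ j / (128 * gain (u k))) by (field; lra).
  apply Rmult_le_compat_l; [apply Rmult_le_pos; apply pow_le; lra|].
  apply Rinv_le_contravar; lra. }
(* The radii exhaust the disk, so tail estimates on the disks of radius [r k] suffice for
   convergence everywhere. *)
assert (Hhalf : forall x, x < 1 -> exists k, x <= r k).
{ intros x Hx; destruct (pow_lt_1_zero (/ 2)) with (y := 1 - x) as [N HN];
    [rewrite Rabs_pos_eq; lra|lra|].
  exists (N + 1)%nat; specialize (HN N (le_n N)).
  rewrite Rabs_pos_eq in HN by (apply pow_le; lra).
  pose proof (next_radius_large _ _ _ _ _ (Hnext N)); unfold r; lra. }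
assert (Hsum : forall x, 0 <= x < 1 -> ex_series (fun k => a k * x ^ p k)).
{ intros x Hx; destruct (Hhalf x) as [k Hk]; [lra|].
  apply (ex_series_incr_n (V := R_NormedModule) _ k).
  apply (ex_series_le (K := R_AbsRing) (V := R_CompleteNormedModule) _
    (fun j => (/ 2) ^ k / (128 * gain (u k)) * (/ 2) ^ j)).
  - intros j; change (Rabs (a (k + j)%nat * x ^ p (k + j)%nat) <=
      (/ 2) ^ k / (128 * gain (u k)) * (/ 2) ^ j).
    rewrite Rabs_pos_eq; [apply Hterm; lra|].
    apply Rmult_le_pos; [apply Ha|apply pow_le; lra].
  - apply (ex_series_scal (V := R_NormedModule) ((/ 2) ^ k / (128 * gain (u k)))).
    exists 2; apply is_series_half. }
assert (Hb : forall w k, Cmod (b w k) = a k * Cmod w ^ p k).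
{ intros w k; unfold b; rewrite Cmod_mult, Cmod_pow, Cmod_R, Rabs_pos_eq; auto. }
assert (Hf : forall w, exists l, disk w ->
  is_series (K := C_AbsRing) (V := C_NormedModule) (b w) l).
{ intros w; destruct (classic (disk w)) as [Hw|Hw]; [|exists (RtoC 0); easy].
  destruct (ex_series_le (K := C_AbsRing) (V := C_CompleteNormedModule) (b w)
    (fun k => a k * Cmod w ^ p k)) as [l Hl].
  - intros k; apply Req_le; exact (Hb w k).
  - apply Hsum; split; [apply Cmod_ge_0|exact Hw].
  - exists l; intros _; exact Hl. }
destruct (choice _ Hf) as [f Hfs].
assert (Hfan : analytic f) by (apply (analytic_series a p); assumption).
assert (Htail : forall k w, Cmod w <= r k ->
  Cmod (f w - partial (u k) w) <= (/ 2) ^ k / (128 * gain (u k)) * 2).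
{ intros k w Hw; apply (is_series_tail_le (b w) (fun k => partial (u k) w)).
  - apply Hfs; unfold disk; specialize (Hr k); lra.
  - now rewrite Hu0.
  - intros j; exact (next_partial _ _ _ _ _ (Hnext j) w).
  - intros j; rewrite Hb; apply Hterm; split; [apply Cmod_ge_0|exact Hw]. }
(* The geometric factor [2] turns the [128] of [next_small] into [64]. *)
assert (Htail' : forall k w, Cmod w <= r k ->
  gain (u k) * Cmod (f w - partial (u k) w) <= / 64).
{ intros k w Hw; specialize (Htail k w Hw).
  pose proof (adm_gain _ _ (Hadm k)).
  assert ((/ 2) ^ k <= 1) by (rewrite <- (pow1 k); apply pow_incr; lra).
  apply Rle_trans with (gain (u k) * ((/ 2) ^ k / (128 * gain (u k)) * 2)).
  - apply Rmult_le_compat_l; lra.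
  - replace (gain (u k) * ((/ 2) ^ k / (128 * gain (u k)) * 2))
      with ((/ 2) ^ k / 64) by (field; lra). lra. }
assert (HfH : Hinf v f).
{ destruct (weight_bound v Hv) as [B [HB0 HB]].
  apply (Hinf_of_bound v f (2 + B)); [easy|].
  (* On the annulus from [r k] to [r (k + 1)] the old sum and the hump contribute at most [1] each,
     and the later terms at most [B]. The base case is empty because [r 0 = 0]. *)
  assert (Hin : forall k w, Cmod w < r k -> v w * Cmod (f w) <= 2 + B).
  { induction k as [|k IH]; intros w Hw.
    - unfold r in Hw; rewrite Hu0 in Hw; simpl in Hw.
      pose proof (Cmod_ge_0 w); lra.
    - destruct (Rlt_le_dec (Cmod w) (r k)) as [Hlt|Hge]; [auto|].
      replace (S k) with (k + 1)%nat in Hw by lia.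
      assert (Dw : disk w) by (unfold disk; specialize (Hr (k + 1)%nat); lra).
      pose proof (weight_positive v Hv w Dw) as Hvw; specialize (HB w Dw).
      pose proof (adm_outside _ _ (Hadm k) w Dw Hge) as H1.
      pose proof (adm_mass _ _ (Hadm k) w Dw) as H2.
      pose proof (next_norm _ _ _ _ _ (Hnext k) w Dw) as H3.
      fold (a k) in H3; fold (p k) in H3; rewrite <- Hb in H3.
      pose proof (Htail' (k + 1)%nat w (Rlt_le _ _ Hw)) as H4.
      pose proof (adm_gain _ _ (Hadm (k + 1)%nat)) as H5.
      pose proof (Cmod_ge_0 (f w - partial (u (k + 1)%nat) w)) as H6.
      assert (H7 : Cmod (f w) <= Cmod (partial (u k) w) + Cmod (b w k)
        + Cmod (f w - partial (u (k + 1)%nat) w)).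
      { rewrite (next_partial _ _ _ _ _ (Hnext k)) at 1.
        fold (a k) (p k) (b w k).
        change (a k * w ^ p k)%C with (b w k).
        replace (f w) with ((partial (u k) w + b w k) + (f w - (partial (u k) w + b w k)))%C at 1 by ring.
        eapply Rle_trans; [apply Cmod_triangle|].
        apply Rplus_le_compat_r, Cmod_triangle. }
      assert (v w * Cmod (partial (u k) w) <= v w * mass (u k))
        by (apply Rmult_le_compat_l; lra).
      assert (v w * Cmod (f w) <= v w * (Cmod (partial (u k) w) + Cmod (b w k)
        + Cmod (f w - partial (u (k + 1)%nat) w)))
        by (apply Rmult_le_compat_l; lra).
      assert (Cmod (f w - partial (u (k + 1)%nat) w) <= 1) by nra.
      assert (v w * Cmod (f w - partial (u (k + 1)%nat) w) <= B * 1)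
        by (apply Rmult_le_compat; lra).
      lra. }
  intros w Hw; unfold disk in Hw.
  destruct (Hhalf ((1 + Cmod w) / 2)) as [k Hk]; [lra|].
  apply (Hin k); lra. }
destruct (cont_space_bound phi v f (/ 64) (Hcont f HfH)) as [d [Hd0 Hdz]]; [lra|].
(* For this [k] the time of the hump is below [d], where the orbit of [f] moves by less than
   [1/64]. *)
destruct (pow_lt_1_zero (/ 2)) with (y := d) as [k Hk];
  [rewrite Rabs_pos_eq; lra|lra|].
specialize (Hk k (le_n k)); rewrite Rabs_pos_eq in Hk by (apply pow_le; lra).
pose proof (Hnext k) as Hs; set (s' := u (k + 1)%nat) in *.
set (t := time s') in *; set (z := point s') in *.
pose proof (next_point _ _ _ _ _ Hs : disk z) as Hz.
pose proof (next_time _ _ _ _ _ Hs : 0 < t < (/ 2) ^ k) as Htt.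
pose proof (Hdz t z ltac:(lra) Hz) as H1.
pose proof (next_old _ _ _ _ _ Hs) as H2.
pose proof (next_new _ _ _ _ _ Hs) as H3.
pose proof (Htail' (k + 1)%nat z (next_point_radius _ _ _ _ _ Hs)) as H4.
pose proof (Htail' (k + 1)%nat (phi t z) (next_image_radius _ _ _ _ _ Hs)) as H5.
pose proof (next_gain_large _ _ _ _ _ Hs) as H6.
fold s' in H4, H5; fold t z in H2, H3, H6.
unfold wcomp in H1, H2.
set (g := C_derive (phi t) z) in *; set (y := phi t z) in *.
set (E := (g * y ^ expo s' - z ^ expo s')%C) in *.
(* The motion of the hump is that of [f], minus that of the old sum, minus that of the tail. Each
   has weighted size at most [1/64] at [z], while the hump exceeds [1/16]. *)
assert (Hsplit : (coef s' * E =
  (g * f y - f z) + - (g * partial (u k) y - partial (u k) z)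
  + (- (g * (f y - partial s' y)) + (f z - partial s' z)))%C).
{ rewrite !(next_partial _ _ _ _ _ Hs); unfold E; fold s'; ring. }
assert (Hle : coef s' * Cmod E <= Cmod (g * f y - f z)
  + Cmod (g * partial (u k) y - partial (u k) z)
  + (Cmod g * Cmod (f y - partial s' y) + Cmod (f z - partial s' z))).
{ rewrite <- (Rabs_pos_eq (coef s')), <- Cmod_R, <- !Cmod_mult
    by exact (next_coef _ _ _ _ _ Hs).
  rewrite Hsplit, <- (Cmod_opp (g * partial (u k) y - partial (u k) z)),
    <- (Cmod_opp (g * (f y - partial s' y))).
  eapply Rle_trans; [apply Cmod_triangle|].
  apply Rplus_le_compat; apply Cmod_triangle. }
pose proof (weight_positive v Hv z Hz) as Hvz.
apply (Rmult_le_compat_l (v z)) in Hle; [|lra].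
pose proof (adm_gain _ _ (Hadm (k + 1)%nat) : 1 <= gain s') as Hg.
assert (Htz : v z * (Cmod g * Cmod (f y - partial s' y) + Cmod (f z - partial s' z)) <= / 64).
{ set (X := Cmod (f y - partial s' y)) in *; set (Y := Cmod (f z - partial s' z)) in *.
  assert (HM : X <= / (64 * gain s') /\ Y <= / (64 * gain s')).
  { rewrite Rinv_mult.
    split; apply Rmult_le_reg_l with (gain s'); try lra;
    replace (gain s' * (/ 64 * / gain s')) with (/ 64) by (field; lra); easy. }
  pose proof (Cmod_ge_0 g).
  apply Rle_trans with (v z * (1 + Cmod g) * / (64 * gain s')).
  - rewrite Rmult_assoc; apply Rmult_le_compat_l; [lra|]. nra.
  - apply Rle_trans with (gain s' * / (64 * gain s')).
    + apply Rmult_le_compat_r; [|easy]. apply Rlt_le, Rinv_0_lt_compat; lra.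
    + apply Req_le; field; lra. }
lra.
Qed.

Theorem theorem22 :
  forall v : C -> R, weight v -> typical v -> quasi_normal v ->
  forall phi : R -> C -> C,
    analytic_semigroup phi -> nontrivial_semigroup phi ->
    (forall t, 0 <= t -> bounded_on v (wcomp phi t)) ->
    (exists M : R, forall t, 0 <= t <= 1 -> Rbar_le (opnorm v (wcomp phi t)) M) ->
    (forall f, cont_space phi v f -> Hinf v f) /\
    (exists f, Hinf v f /\ ~ cont_space phi v f).
Proof.
intros v Hv Ht _ phi Hphi Hnt Hb _; split; [intros f Hf; apply Hf|].
apply NNPP; intros Hn.
apply (exists_discontinuous_orbit v phi Hv Ht Hphi Hnt).
- intros t Ht0.
  (* The operator sends the constant [1] to [phi_t'], which is therefore analytic. *)
  assert (H1 : Hinf v (fun _ => 1)).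
  { apply (Hinf_of_bounded v _ 1 Hv).
    - intros z Hz; apply (ex_derive_const (V := C_NormedModule)).
    - intros z Hz; rewrite Cmod_1; lra. }
  apply (analytic_ext (wcomp phi t (fun _ => 1))).
  + intros z Hz; unfold wcomp; ring.
  + apply (proj1 (Hb t Ht0) _ H1).
- intros f Hf; apply NNPP; intros Hc; apply Hn; eauto.
Qed.
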